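(* Let $\alpha$ be a composition. Then $$\mathcal S_\alpha=\sum_\beta d_{\alpha\beta}F_\beta,$$ summed over compositions $\beta$, where $d_{\alpha\beta}$ is the number of standard augmented fillings (SAFs) $T$ of shape $\gamma$, for some weak composition $\gamma$ with positive last part and $\alpha(\gamma)=\alpha$, such that $\beta(\mathcal D(T))=\beta$; equivalently, $d_{\alpha\beta}$ is the number of standard ComTs $T$ of shape $\alpha$ with $\beta(\mathcal D(T))=\beta$.
   Context: A weak composition is a finite sequence $\gamma=(\gamma_1,\dots,\gamma_n)$ of nonnegative integers; a composition has all parts positive; $|\gamma|=\sum\gamma_i$; $\alpha(\gamma)$ is obtained from $\gamma$ by deleting zero parts. For $S=\{i_1<\dots<i_{k-1}\}\subseteq\{1,\dots,N-1\}$, $\beta(S)=(i_1,i_2-i_1,\dots,N-i_{k-1})$. For a composition $\alpha=(\alpha_1,\dots,\alpha_k)$, $M_\alpha=\sum_{i_1<\dots<i_k}x_{i_1}^{\alpha_1}\cdots x_{i_k}^{\alpha_k}$ and $F_\alpha=\sum_\beta M_\beta$ over compositions $\beta$ such that $\alpha$ is obtained from $\beta$ by adding adjacent parts. SSAFs. The augmented diagram of $\gamma=(\gamma_1,\dots,\gamma_n)$ has cells $(i,j)$, $1\le i\le n$ (row, from top), $0\le j\le\gamma_i$ (column); column $0$ is the basement, cell $(i,0)$ containing $i$. An augmented filling assigns positive integers to non-basement cells. Cells $(i,j),(i',j')$ attack if $j=j'$, or $j=j'+1$ and $i>i'$; non-attacking means distinct attacking cells (basement included) have distinct entries. When comparing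 entries in a triple, of two equal entries the one appearing first when read top to bottom, right to left counts as smaller. Type A triple: $c=(i,k-1)$, $a=(i,k)$, $b=(j,k)$, $i<j$, $k\ge1$, $\gamma_i\ge\gamma_j$; inversion triple if in increasing order $a<c<b$, $c<b<a$ or $b<a<c$. Type B triple: $a=(i,k)$, $b=(j,k)$, $c=(j,k+1)$, $i<j$, $k\ge0$, $\gamma_j>\gamma_i$; inversion triple if in increasing order $a<c<b$, $c<b<a$ or $b<a<c$. An SSAF of shape $\gamma$ is a non-attacking augmented filling with rows (basement included) weakly decreasing left to right and all type A and B triples inversion triples; $x^F=\prod_i x_i^{w_i(F)}$ with $w_i(F)$ the number of non-basement cells containing $i$. An SAF of shape $\gamma$ is an SSAF with $x^F=x_1x_2\cdots x_{|\gamma|}$; its descent set $\mathcal D(F)$ is the set of $i\in\{1,\dots,|\gamma|-1\}$ such that the non-basement cell containing $i+1$ is not in a column strictly left of the non-basement cell containing $i$. $\mathcal A_\gamma=\sum_F x^F$ over SSAFs of shape $\gamma$; $\mathcal S_\alpha=\sum_\gamma \mathcal A_\gamma$ over weak compositions $\gamma$ with positive last part and $\alpha(\gamma)=\alpha$. ComTs. For a composition $\alpha=(\alpha_1,\dots,\alpha_\ell)$ with largest part $m$, a ComT of shape $\alpha$ is a filling of the left-justified diagram with $\alpha_i$ cells in row $i$ by positive integers with rows weakly decreasing left to right, leftmost column strictly increasing top to bottom, and such that, padding rows with $0$'s to an $\ell\times m$ array $\hat T$, for $1\le i<j\le\ell$, $2\le k\le m$: $\hat T(j,k)\ne0$ and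 $\hat T(j,k)\ge\hat T(i,k)$ imply $\hat T(j,k)>\hat T(i,k-1)$. It is standard if its $N$ cells contain $1,\dots,N$ once each; then $\mathcal D(T)$ is the set of $i\in\{1,\dots,N-1\}$ such that $i+1$ does not appear in a column strictly left of the column of $i$. *)

(* Defs.v *)
From mathcomp Require Import all_boot all_order all_algebra.
From mathcomp Require Import finmap multiset.
From mathcomp Require Import boolp classical_sets functions cardinality fsbigop.

Set Implicit Arguments.
Unset Strict Implicit.
Unset Printing Implicit Defensive.

Import GRing.Theory.

Local Open Scope classical_set_scope.
Local Open Scope ring_scope.
Local Open Scope nat_scope.

(** * Formal power series in x_1, x_2, ... *)

(** A monomial is the multiset of its variable indices (the multiplicity of [i]
    is the exponent of [x_i]); a series is its coefficient function. The index
    [0] is available in the type, but no series below involves [x_0]. *)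
Notation monomial := ({mset nat}%mset).

Definition fps := monomial -> int.

Definition mono (u : monomial) : fps := fun m => (m == u)%:R%R.

(** Infinite sums are taken coefficientwise. [\sum_(i \in A)] is [0] when the
    support is infinite; the [summable_*] lemmas at the end of this file show
    that every family summed below is summable. *)
Definition summable (I : choiceType) (A : set I) (f : I -> fps) : Prop :=
  forall m, finite_set [set i | A i /\ f i m <> 0%R].

Definition psum (I : choiceType) (A : set I) (f : I -> fps) : fps :=
  fun m => (\sum_(i \in A) f i m)%R.

(** * Compositions *)

(** Weak compositions are arbitrary elements of [seq nat]; the weight is [sumn]. *)
Definition is_composition (a : seq nat) : bool := all (leq 1) a.

Definition compress (g : seq nat) : seq nat := [seq x <- g | 0 < x].

(** For [g = [::]] the condition on the last part is vacuous, so that the empty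
    composition has exactly one expansion, [[::]]. *)
Definition expansion (a g : seq nat) : Prop := 0 < last 1 g /\ compress g = a.

(** beta(S) for the subset S of {1, ..., N-1} listed increasingly by [s]. *)
Definition beta (N : nat) (s : seq nat) : seq nat :=
  if N == 0 then [::] else pairmap (fun x y => y - x) 0 (rcons s N).

(** [a] is obtained from [b] by adding adjacent parts: [bs] cuts [b] into
    nonempty consecutive blocks whose sums are the parts of [a]. *)
Definition coarsening (a b : seq nat) : Prop :=
  exists bs : seq (seq nat),
    [/\ [::] \notin bs, flatten bs = b & map sumn bs = a].

(** * Monomial and fundamental quasisymmetric functions *)

Definition M_index (a : seq nat) : set (seq nat) :=
  [set i | [/\ size i = size a, all (leq 1) i & sorted ltn i]].

Definition M_term (a i : seq nat) : monomial :=
  \big[msetD/mset0]_(p <- zip i a) msetn p.2 p.1.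

Definition qsym_M (a : seq nat) : fps :=
  psum (M_index a) (fun i => mono (M_term a i)).

Definition F_index (a : seq nat) : set (seq nat) :=
  [set b | is_composition b /\ coarsening a b].

Definition qsym_F (a : seq nat) : fps := psum (F_index a) qsym_M.

(** * Fillings *)

(** A filling is the list of its rows from top to bottom, each row being the
    list of its (non-basement) entries from left to right; its shape is
    [seq.shape]. Rows and columns are numbered from 1 and column 0 is the
    basement. *)
Definition filling := seq (seq nat).

Definition part (g : seq nat) (i : nat) : nat := nth 0 g i.-1.

(** 1-based access, padding with 0. *)
Definition entry (T : filling) (i k : nat) : nat := nth 0 (nth [::] T i.-1) k.-1.

Definition content (T : filling) : monomial := seq_mset (flatten T).

Definition positive_entries (T : filling) : bool := all (all (leq 1)) T.

(** Column of the first cell containing [v] (the only one if [T] is standard). *)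
Definition column (T : filling) (v : nat) : nat :=
  (index v (nth [::] T (find (fun r => v \in r) T))).+1.

(** The set {1, ..., N-1} cut down to the descents, listed increasingly. *)
Definition descents (T : filling) : seq nat :=
  [seq i <- iota 1 (size (flatten T)).-1 | ~~ (column T i.+1 < column T i)].

Definition descent_composition (T : filling) : seq nat :=
  beta (size (flatten T)) (descents T).

(** * Semi-standard augmented fillings *)

Definition cell := (nat * nat)%type.

Definition in_aug_diagram (g : seq nat) (c : cell) : bool :=
  (0 < c.1 <= size g) && (c.2 <= part g c.1).

Definition aug_entry (T : filling) (c : cell) : nat :=
  if c.2 == 0 then c.1 else entry T c.1 c.2.

Definition attack (c d : cell) : bool :=
  (c.2 == d.2) || ((c.2 == d.2.+1) && (d.1 < c.1)).

Definition non_attacking (g : seq nat) (T : filling) : Prop :=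
  forall c d : cell, in_aug_diagram g c -> in_aug_diagram g d ->
    c != d -> attack c d -> aug_entry T c != aug_entry T d.

(** Columns from right to left, each column from top to bottom. *)
Definition read_before (c d : cell) : bool :=
  (d.2 < c.2) || ((c.2 == d.2) && (c.1 < d.1)).

Definition cell_lt (T : filling) (c d : cell) : bool :=
  (aug_entry T c < aug_entry T d)
  || ((aug_entry T c == aug_entry T d) && read_before c d).

Definition inversion_triple (T : filling) (a b c : cell) : bool :=
  [|| cell_lt T a c && cell_lt T c b,
      cell_lt T c b && cell_lt T b a
    | cell_lt T b a && cell_lt T a c].

Definition type_A_ok (g : seq nat) (T : filling) : Prop :=
  forall i j k : nat, 0 < i -> i < j -> 0 < k -> part g j <= part g i ->
    in_aug_diagram g (i, k) -> in_aug_diagram g (j, k) ->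
    inversion_triple T (i, k) (j, k) (i, k.-1).

Definition type_B_ok (g : seq nat) (T : filling) : Prop :=
  forall i j k : nat, 0 < i -> i < j -> part g i < part g j ->
    in_aug_diagram g (i, k) -> in_aug_diagram g (j, k.+1) ->
    inversion_triple T (i, k) (j, k) (j, k.+1).

Definition aug_rows_decreasing (g : seq nat) (T : filling) : Prop :=
  forall i k : nat, in_aug_diagram g (i, k.+1) ->
    aug_entry T (i, k.+1) <= aug_entry T (i, k).

Definition SSAF (g : seq nat) : set filling :=
  [set T | [/\ shape T = g, positive_entries T & non_attacking g T] /\
           [/\ aug_rows_decreasing g T, type_A_ok g T & type_B_ok g T]].

Definition SAF (g : seq nat) : set filling :=
  [set T | SSAF g T /\ content T = seq_mset (iota 1 (sumn g))].

Definition dem_atom (g : seq nat) : fps :=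
  psum (SSAF g) (fun T => mono (content T)).

Definition quasi_schur (a : seq nat) : fps := psum (expansion a) dem_atom.

(** * Composition tableaux *)

Definition ComT (a : seq nat) : set filling :=
  [set T | [/\ shape T = a, positive_entries T,
      all (sorted geq) T,
      (forall i j, 0 < i -> i < j -> j <= size a -> entry T i 1 < entry T j 1)
    & (forall i j k, 0 < i -> i < j -> j <= size a ->
         2 <= k <= \max_(x <- a) x ->
         entry T j k != 0 -> entry T i k <= entry T j k ->
         entry T i k.-1 < entry T j k)]].

Definition standard_ComT (a : seq nat) : set filling :=
  [set T | ComT a T /\ perm_eq (flatten T) (iota 1 (sumn a))].

(** * The coefficients *)

(** [#|` fset_set A|] is the cardinal of a finite set [A]; finiteness of the two
    sets counted is [finite_d_SAF_set] and [finite_d_ComT_set]. *)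
Definition d_SAF_set (a b : seq nat) : set filling :=
  [set T | (exists2 g, expansion a g & SAF g T) /\ descent_composition T = b].

Definition d_SAF (a b : seq nat) : nat := #|` fset_set (d_SAF_set a b)|%fset.

Definition d_ComT_set (a b : seq nat) : set filling :=
  [set T | standard_ComT a T /\ descent_composition T = b].

Definition d_ComT (a b : seq nat) : nat := #|` fset_set (d_ComT_set a b)|%fset.

Definition composition_set : set (seq nat) := [set b | is_composition b].

(** * Well-definedness of the sums and cardinals above *)

Lemma finite_bounded_seqs (T : eqType) (l : seq T) (n : nat) :
  finite_set [set s : seq T | size s <= n /\ {subset s <= l}].
Proof.
elim: n => [|n IHn].
  apply: (sub_finite_set _ (finite_set1 [::])) => s /= [+ _].
  by rewrite leqn0 => /nilP.
apply: (@sub_finite_set _ _ ([set [::]] `|`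
  [set x :: s | x in [set` l] & s in
     [set s : seq T | size s <= n /\ {subset s <= l}]])).
  case=> [|x s] /= [sn sl]; first by left.
  right; exists x; first exact/sl/mem_head.
  by exists s => //; split=> // y ys; apply: sl; rewrite in_cons ys orbT.
rewrite finite_setU; split; first exact: finite_set1.
by apply: finite_image2.
Qed.

Lemma mono_neq0 (u m : monomial) : mono u m <> 0%R -> m = u.
Proof. by rewrite /mono; case: eqP. Qed.

Lemma content_perm (T : filling) (m : monomial) :
  m = content T -> perm_eq (flatten T) m.
Proof. by move=> ->; rewrite perm_sym; apply: perm_eq_seq_mset. Qed.

Lemma finite_fillings (G : set (seq nat)) (l : seq nat) : finite_set G ->
  finite_set [set T : filling | G (shape T) /\ perm_eq (flatten T) l].
Proof.
move=> finG; apply: (sub_finite_set _ (finite_image2 (fun g s => reshape g s)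
  finG (finite_bounded_seqs l (size l)))) => T /= [GT Tl].
exists (shape T) => //; exists (flatten T); last exact: flattenK.
by split=> [|x]; rewrite ?(perm_size Tl) // (perm_mem Tl).
Qed.

Lemma mem_M_term (a i : seq nat) (x : nat) :
  is_composition a -> size i = size a -> x \in i -> x \in M_term a i.
Proof.
rewrite /M_term; elim: i a => [|y i IHi] [|p a] //= /andP[p0 ca] [ia].
rewrite in_cons big_cons in_msetD in_msetn p0 /= => /orP[->//|xi].
by rewrite IHi ?orbT.
Qed.

Lemma summable_M (a : seq nat) : is_composition a ->
  summable (M_index a) (fun i => mono (M_term a i)).
Proof.
move=> ca m; apply: (sub_finite_set _ (finite_bounded_seqs m (size a))).
move=> i [[ia _ _] /mono_neq0 ->]; split; first by rewrite ia.
by move=> x; apply: mem_M_term.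
Qed.

Lemma leq_sumn (x : nat) (s : seq nat) : x \in s -> x <= sumn s.
Proof.
elim: s => //= y s IHs; rewrite in_cons => /orP[/eqP->|/IHs]; first exact: leq_addr.
by move=> /leq_trans; apply; apply: leq_addl.
Qed.

Lemma size_composition (b : seq nat) : is_composition b -> size b <= sumn b.
Proof. by elim: b => //= x b IHb /andP[x0 /IHb]; rewrite -addn1 addnC; apply: leq_add. Qed.

Lemma finite_F_index (a : seq nat) : finite_set (F_index a).
Proof.
apply: (sub_finite_set _ (finite_bounded_seqs (iota 0 (sumn a).+1) (sumn a))).
move=> b [cb [bs [_ bsb bsa]]].
have eqs : sumn b = sumn a.
  by rewrite -bsb -bsa; elim: (bs) => //= s ss <-; rewrite sumn_cat.
split; first by rewrite -eqs size_composition.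
by move=> x xb; rewrite mem_iota /= ltnS -eqs leq_sumn.
Qed.

Lemma summable_F (a : seq nat) : summable (F_index a) qsym_M.
Proof. by move=> m; apply: sub_finite_set (finite_F_index a) => b []. Qed.

Lemma summable_dem_atom (g : seq nat) :
  summable (SSAF g) (fun T => mono (content T)).
Proof.
move=> m; apply: (sub_finite_set _ (finite_fillings m (finite_set1 g))).
by move=> T [[[Tg _ _] _] /mono_neq0 mT]; split=> //; apply: content_perm.
Qed.

(** The first column of an SSAF repeats the basement. *)
Lemma SSAF_col1 (g : seq nat) (T : filling) (i : nat) :
  SSAF g T -> 0 < i <= size g -> 0 < part g i -> entry T i 1 = i.
Proof.
move=> [[Tg posT naT] [decT _ _]] iP gi.
have i1 : in_aug_diagram g (i, 1) by rewrite /in_aug_diagram /= iP.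
have := decT i 0 i1; rewrite /aug_entry /= leq_eqVlt => /orP[/eqP //|lti].
move: iP i1 => /andP[i0 ig] i1.
have gt0 : 0 < entry T i 1.
  have iT : i.-1 < size T by rewrite -(size_map size) -/(shape T) Tg prednK.
  move/allP: posT => /(_ (nth [::] T i.-1)) /(_ (mem_nth _ iT)) /allP; apply.
  apply: mem_nth; rewrite -(nth_map _ 0 size) //.
  by rewrite -/(shape T) Tg.
have : aug_entry T (i, 1) != aug_entry T (entry T i 1, 0).
  apply: naT; rewrite ?/attack ?xpair_eqE ?andbF //=.
  by rewrite /in_aug_diagram /= gt0 (leq_trans (ltnW lti)).
by rewrite /aug_entry /= eqxx.
Qed.

Lemma finite_expansions (a l : seq nat) : finite_set
  [set g | expansion a g /\ exists2 T, SSAF g T & perm_eq (flatten T) l].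
Proof.
apply: (sub_finite_set _ (finite_bounded_seqs (0 :: a) (sumn l))).
move=> g [[lastg ga] [T gT Tl]]; split.
  have [->//|g0] := eqVneq g [::].
  have sg : 0 < size g by case: (g) g0.
  have gP : 0 < part g (size g).
    by rewrite /part nth_last; case: (g) g0 lastg.
  have sgP : 0 < size g <= size g by rewrite sg leqnn.
  have := SSAF_col1 gT sgP gP; rewrite /entry => <-.
  apply: leq_sumn; rewrite -(perm_mem Tl).
  case: gT => [[Tg _ _] _].
  have iT : (size g).-1 < size T by rewrite -(size_map size) -/(shape T) Tg prednK.
  apply/flattenP; exists (nth [::] T (size g).-1); first exact: mem_nth.
  by apply: mem_nth; rewrite -(nth_map _ 0 size) // -/(shape T) Tg.
move=> x xg; rewrite in_cons -ga mem_filter xg andbT lt0n.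
by case: eqP.
Qed.

Lemma summable_quasi_schur (a : seq nat) : summable (expansion a) dem_atom.
Proof.
move=> m; apply: (sub_finite_set _ (finite_expansions a m)) => g [ag gm].
split=> //; apply: contrapT => noT; apply: gm.
rewrite /dem_atom /psum fsbig1 // => T gT.
apply: contrapT => /mono_neq0/content_perm Tm; apply: noT.
by exists T.
Qed.

Lemma sumn_compress (g : seq nat) : sumn (compress g) = sumn g.
Proof. by elim: g => //= -[|x] g IHg //=; rewrite IHg. Qed.

Lemma finite_SAFs (a : seq nat) :
  finite_set [set T | exists2 g, expansion a g & SAF g T].
Proof.
apply: (sub_finite_set _ (finite_fillings (iota 1 (sumn a))
  (finite_expansions a (iota 1 (sumn a))))) => T [g ag [gT cT]].
have Tl : perm_eq (flatten T) (iota 1 (sumn a)).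
  by case: ag => _ <-; rewrite sumn_compress; apply/eq_seq_msetP.
have Tg : shape T = g by case: gT => -[].
split=> //=; rewrite Tg; split=> //; by exists T.
Qed.

Lemma finite_d_SAF_set (a b : seq nat) : finite_set (d_SAF_set a b).
Proof. by apply: sub_finite_set (finite_SAFs a) => T []. Qed.

Lemma finite_d_ComT_set (a b : seq nat) : finite_set (d_ComT_set a b).
Proof.
apply: (sub_finite_set _ (finite_fillings (iota 1 (sumn a)) (finite_set1 a))).
by move=> T [[[Ta _ _ _ _] ?] _].
Qed.

Lemma summable_expansion_F (a : seq nat) :
  summable composition_set (fun b => (qsym_F b *+ d_SAF a b)%R).
Proof.
move=> m; apply: (sub_finite_set _ (finite_image descent_composition (finite_SAFs a))).
move=> b [_ bm]; apply: contrapT => noT; apply: bm.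
suff -> : d_SAF a b = 0 by rewrite mulr0n.
rewrite /d_SAF (_ : d_SAF_set a b = set0) ?fset_set0 ?cardfs0 //.
by apply/seteqP; split=> // T [aT Tb]; apply: noT; exists T.
Qed.

(* Main.v *)
(** The first column of an SSAF repeats its basement, hence deleting the empty rows
    is a content- and column-preserving bijection from the SSAFs whose shape
    expands [a] onto the ComTs of shape [a]; its inverse puts each row back at the
    height given by its first entry. This identifies the two counts [d_SAF] and
    [d_ComT], and reduces the expansion to ComTs.

    The entries of a column of a ComT are distinct, so its cells can be numbered
    by increasing entry, equal entries being numbered from right to left. This
    standardization is again a ComT, and for a monomial [m] with sorted word [w] it
    identifies the ComTs of content [m] with the standard ComTs [S] such that [w]
    increases strictly at each descent of [S]. The latter condition says that the
    descent composition of [S] is a coarsening of the exponents of [m], i.e. that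
    [m] occurs, with coefficient 1, in the fundamental function of [S]. *)

Require Import Defs.
From mathcomp Require Import all_boot all_order all_algebra.
From mathcomp Require Import finmap multiset.
From mathcomp Require Import boolp classical_sets functions cardinality fsbigop.
From mathcomp Require Import zify.

Set Implicit Arguments.
Unset Strict Implicit.
Unset Printing Implicit Defensive.

Import GRing.Theory.

Local Open Scope classical_set_scope.
Local Open Scope nat_scope.

(** * Semi-standard augmented fillings by rows *)

(* The triple rule for a row [r] above a row [r'], columns being numbered from 0;
   as entries are positive, "T(j,k) is nonzero" means that [r'] has a column [k]. *)
Definition row_ok (r r' : seq nat) : bool :=
  all (fun k => (nth 0 r k <= nth 0 r' k) ==> (nth 0 r k.-1 < nth 0 r' k))
      (iota 1 (size r').-1).

Lemma row_okP (r r' : seq nat) :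
  reflect (forall k, 0 < k < size r' -> nth 0 r k <= nth 0 r' k ->
             nth 0 r k.-1 < nth 0 r' k)
          (row_ok r r').
Proof.
apply: (iffP allP) => H k.
  by move=> kr; apply/implyP/H; rewrite mem_iota; lia.
by rewrite mem_iota => kr; apply/implyP/H; lia.
Qed.

Definition first_lt (r r' : seq nat) : bool := nth 0 r 0 < nth 0 r' 0.

Lemma positive_entriesP (T : filling) :
  reflect (forall i k, k < size (nth [::] T i) -> 0 < nth 0 (nth [::] T i) k)
          (positive_entries T).
Proof.
apply: (iffP (all_nthP [::])) => H i.
  move=> k kT; have [iT|iT] := ltnP i (size T); last by rewrite nth_default in kT.
  by move/(all_nthP 0): (H i iT); apply.
by move=> iT; apply/(all_nthP 0) => k; apply: H.
Qed.

Lemma sorted_geq_rowsP (T : filling) :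
  reflect (forall i k, k.+1 < size (nth [::] T i) ->
             nth 0 (nth [::] T i) k.+1 <= nth 0 (nth [::] T i) k)
          (all (sorted geq) T).
Proof.
apply: (iffP (all_nthP [::])) => H i.
  move=> k kT; have [iT|iT] := ltnP i (size T); last by rewrite nth_default in kT.
  by move/(sortedP 0): (H i iT); apply.
by move=> iT; apply/(sortedP 0) => k; apply: H.
Qed.

(** By positivity, a nonzero padded entry marks a column that the lower row really has. Such a
    column lies within the longest row, which supplies the bound on [k] in [ComT]. *)
Lemma ComTP (a : seq nat) (U : filling) :
  ComT a U <-> [/\ shape U = a, positive_entries U, all (sorted geq) U,
                   pairwise first_lt U & pairwise row_ok U].
Proof.
split=> -[Ua posU decU H1 H2]; split=> //; have sU : size U = size a
  by rewrite -Ua size_map.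
- apply/(pairwiseP [::]) => i j; rewrite !inE => iU jU ij.
  by apply: (H1 i.+1 j.+1); lia.
- apply/(pairwiseP [::]) => i j; rewrite !inE => iU jU ij.
  apply/row_okP => k /andP[k0 kj] le_ij.
  have := H2 i.+1 j.+1 k.+1; rewrite /entry /=.
  apply => //; first lia.
    have kjm : size (nth [::] U j) <= \max_(x <- a) x.
      by rewrite -Ua; apply: leq_bigmax_seq => //; apply/map_f/mem_nth.
    by apply/andP; split=> //; apply: leq_trans kj kjm.
  by rewrite -lt0n; apply: (positive_entriesP _ posU).
- move=> [|i] [|j] // _ ij ja; apply: (pairwiseP [::] H1) => //; rewrite inE; lia.
- move=> [|i] [|j] [|[|k]] // _ ij ja _; rewrite /entry /= => jk le_ij.
  have [{}ij jU] : i < j /\ j < size U by split; lia.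
  have okij := pairwiseP [::] H2 i j (ltn_trans ij jU) jU ij.
  apply: (row_okP _ _ okij k.+1) => //.
  by rewrite /= ltnNge; apply: contra jk => /(nth_default 0) ->.
Qed.

(** [n] stands for the number of rows above [T], so that the condition passes to the tail of [T]
    with [n.+1] and supports induction on [T]. *)
Definition basement_rows (n : nat) (T : filling) : Prop :=
  forall i, i < size T -> nth [::] T i != [::] ->
    nth 0 (nth [::] T i) 0 = (n + i).+1.

Lemma part_shape (T : filling) (i : nat) :
  part (shape T) i.+1 = size (nth [::] T i).
Proof.
rewrite /part /= /shape; have [iT|iT] := ltnP i (size T).
  by rewrite (nth_map [::]).
by rewrite !nth_default ?size_map.
Qed.

Lemma in_shape (T : filling) (i k : nat) :
  in_aug_diagram (shape T) (i.+1, k) =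
  (i < size T) && (k <= size (nth [::] T i)).
Proof. by rewrite /in_aug_diagram /= part_shape size_map. Qed.

(** In different columns the cell further right is read first and counts as smaller in a tie.
    Comparisons are thus strict from left to right and weak from right to left. *)
Lemma cell_lt_right (T : filling) (i j k l : nat) : k < l ->
  cell_lt T (i, k) (j, l) = (aug_entry T (i, k) < aug_entry T (j, l)).
Proof.
by move=> kl; rewrite /cell_lt /read_before /=; lia.
Qed.

Lemma cell_lt_left (T : filling) (i j k l : nat) : l < k ->
  cell_lt T (i, k) (j, l) = (aug_entry T (i, k) <= aug_entry T (j, l)).
Proof. by move=> kl; rewrite /cell_lt /read_before /= kl andbT orbC -leq_eqVlt. Qed.

(** Induction on the column, starting from the basement. Once [a < b] holds, the only cyclic order
    left for the type B triple is [a < c < b], which gives the second inequality; as row [i]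
    decreases, the first one follows in the next column. *)
Lemma SSAF_longer_lower_row (T : filling) (i j k : nat) : SSAF (shape T) T ->
  i < j < size T -> size (nth [::] T i) < size (nth [::] T j) ->
  k <= size (nth [::] T i) ->
  aug_entry T (i.+1, k) < aug_entry T (j.+1, k) /\
  aug_entry T (i.+1, k) < aug_entry T (j.+1, k.+1).
Proof.
move=> [[_ posT naT] [decT _ tB]] /andP[ij jT] sij.
have iT : i < size T by lia.
have step l : l <= size (nth [::] T i) ->
    aug_entry T (i.+1, l) < aug_entry T (j.+1, l) ->
    aug_entry T (i.+1, l) < aug_entry T (j.+1, l.+1).
  move=> li lt_ij; have := tB i.+1 j.+1 l; rewrite !part_shape !in_shape iT jT /=.
  move=> /(_ isT ij sij li (leq_ltn_trans li sij)).
  rewrite /inversion_triple cell_lt_right // cell_lt_left //.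
  have -> : cell_lt T (j.+1, l) (i.+1, l) = false.
    by rewrite /cell_lt; move: lt_ij; lia.
  by rewrite !andbF /= orbF => /andP[].
elim: k => [|k IHk] ki; first by split; last apply: step.
have [lt1 lt2] := IHk (ltnW ki).
suff lt3 : aug_entry T (i.+1, k.+1) < aug_entry T (j.+1, k.+1).
  by split; last apply: step.
have di : in_aug_diagram (shape T) (i.+1, k.+1) by rewrite in_shape iT.
have dj : in_aug_diagram (shape T) (j.+1, k.+1).
  by rewrite in_shape jT (leq_trans ki (ltnW sij)).
by rewrite (leq_ltn_trans _ lt2) ?decT.
Qed.

(** If the lower row is longer, [SSAF_longer_lower_row] applies. Otherwise the entries [a], [b] of
    the type A triple are distinct since the filling is non-attacking, so [a < b], and the triple
    must satisfy [a < c < b]. *)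
Lemma SSAF_row_ok (T : filling) : SSAF (shape T) T -> pairwise row_ok T.
Proof.
move=> sT; have := sT; move=> [[_ posT naT] [decT tA tB]].
apply/(pairwiseP [::]) => i j; rewrite !inE => iT jT ij.
apply/row_okP => -[|k] //= kj le_ij.
have [sij|sij] := ltnP (size (nth [::] T i)) (size (nth [::] T j)).
  (* Past the end of row [i] the entry to compare is the padding [0], below every positive entry. *)
  have [ki|ki] := ltnP (size (nth [::] T i)) k.+1.
    by rewrite (nth_default _ ki); have := positive_entriesP _ posT j k.+1 kj; lia.
  by have [_] := @SSAF_longer_lower_row T i j k.+1 sT (introT andP (conj ij jT)) sij ki.
have := tA i.+1 j.+1 k.+2; rewrite !part_shape !in_shape iT jT /=.
move=> /(_ isT ij isT sij (leq_trans kj sij) kj).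
rewrite /inversion_triple.
have dj : in_aug_diagram (shape T) (j.+1, k.+2) by rewrite in_shape jT.
have di : in_aug_diagram (shape T) (i.+1, k.+2).
  by rewrite in_shape iT (leq_trans kj sij).
have neq : aug_entry T (i.+1, k.+2) != aug_entry T (j.+1, k.+2).
  apply: naT => //; last by rewrite /attack eqxx.
  by rewrite xpair_eqE; lia.
have -> : cell_lt T (j.+1, k.+2) (i.+1, k.+2) = false.
  rewrite /cell_lt (eq_sym _ (aug_entry T (i.+1, k.+2))) (negPf neq) orbF.
  by apply/negbTE; rewrite -leqNgt.
by rewrite !andbF /= orbF => /andP[_]; rewrite cell_lt_right.
Qed.

Lemma SSAF_basement_rows (T : filling) :
  SSAF (shape T) T -> basement_rows 0 T.
Proof.
move=> sT i iT; rewrite -size_eq0 -lt0n => Ti0.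
by have := @SSAF_col1 _ T i.+1 sT; rewrite part_shape size_map iT; apply.
Qed.

Lemma SSAF_of_rows (T : filling) : positive_entries T -> all (sorted geq) T ->
  basement_rows 0 T -> pairwise row_ok T -> SSAF (shape T) T.
Proof.
move=> posT /sorted_geq_rowsP decT bT okT.
pose E i k := aug_entry T (i.+1, k).
have E1 i : i < size T -> 0 < size (nth [::] T i) -> E i 1 = i.+1.
  by move=> iT; rewrite lt0n size_eq0 => /(bT i iT).
have dec i k : i < size T -> k < size (nth [::] T i) -> E i k.+1 <= E i k.
  by case: k => [|k] iT ki; [rewrite E1|apply: decT].
have ok i j k : i < j < size T -> 0 < k < size (nth [::] T j) ->
    E i k.+1 <= E j k.+1 -> E i k < E j k.+1.
  case: k => // k /andP[ij jT] kj; have iT := ltn_trans ij jT.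
  by apply: (row_okP _ _ (pairwiseP [::] okT i j iT jT ij) k.+1).
(* Beyond column 1, equality in a column would give [E i k.-1 < E j k = E i k] by [ok], against
   [dec]. *)
have col i j k : i < j < size T -> k <= size (nth [::] T i) ->
    k <= size (nth [::] T j) -> E i k != E j k.
  move=> /andP[ij jT]; have iT := ltn_trans ij jT.
  case: k => [|[|k]] ki kj; rewrite ?E1 //; first by rewrite /E /aug_entry /=; lia.
    lia.
  have := ok i j k.+1; rewrite ij jT kj => /(_ isT isT).
  by have := dec i k.+1 iT ki; lia.
(* For [0 < k], compare [E i k.+1] with [E j k.+1]: if it is at most that, [ok] separates the two
   cells; if it is larger, so is [E i k], by [dec]. *)
have diag i j k : i < j < size T -> k <= size (nth [::] T i) ->
    k < size (nth [::] T j) -> E i k != E j k.+1.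
  move=> ijT; case/andP: (ijT) => ij jT; have iT := ltn_trans ij jT.
  case: k => [|k] ki kj; first by rewrite E1 // /E /aug_entry /=; lia.
  have [le_ij|lt_ij] := leqP (E i k.+2) (E j k.+2).
    by have := ok i j k.+1 ijT kj le_ij; lia.
  have [ki'|ki'] := ltnP k.+1 (size (nth [::] T i)).
    by have := dec i k.+1 iT ki'; lia.
  by move: lt_ij; rewrite {2}/E /aug_entry /= /entry /= nth_default.
(* Outside the basement this is a descending induction on the column. At the end of row [i] the next
   entry is the padding [0], so [ok] applies; before it, [E i k.+1 < E j k.+2 <= E j k.+1] provides
   the premise of [ok]. *)
have longer i j : i < j < size T ->
    size (nth [::] T i) < size (nth [::] T j) ->
    forall k, k <= size (nth [::] T i) -> E i k < E j k.+1.
  move=> ijT sij [|k] ki; case/andP: (ijT) => ij jT; have iT := ltn_trans ij jT.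
    by rewrite E1 ?(leq_ltn_trans _ sij) //; rewrite /E /aug_entry /=; lia.
  have [d dk] : exists d, k.+1 + d = size (nth [::] T i).
    by exists (size (nth [::] T i) - k.+1); rewrite subnKC.
  elim: d k ki dk => [|d IHd] k ki dk; apply: ok => //; try lia.
    by rewrite {1}/E /aug_entry /= /entry /= nth_default //; lia.
  have kd : k.+2 <= size (nth [::] T i) by lia.
  have := IHd k.+1 kd; rewrite addSnnS => /(_ dk) /ltnW /leq_trans; apply.
  by apply: dec => //; lia.
split; split=> //.
- move=> [[|i] k] [[|j] l] //; rewrite !in_shape xpair_eqE eqSS.
  move=> /andP[iT ki] /andP[jT kj] neq; rewrite /attack /= => /orP[/eqP ekl|].
    rewrite -{}ekl eqxx andbT in kj neq *.
    have [ij|ji|/eqP] := ltngtP i j; last by rewrite (negPf neq).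
      by apply: col => //; rewrite ij.
    by rewrite eq_sym; apply: col => //; rewrite ji.
  move=> /andP[/eqP ekl ji]; rewrite -> ekl in *.
  by rewrite eq_sym; apply: diag => //; rewrite -ltnS ji.
- by move=> [|i] k //; rewrite in_shape => /andP[iT ki]; apply: dec.
- move=> [|i] [|j] [|k] // _ ij _; rewrite !part_shape !in_shape => sij.
  move=> /andP[iT ki] /andP[jT kj]; rewrite /inversion_triple /=.
  rewrite cell_lt_left // cell_lt_right // -!/(E _ _) dec //=.
  have ijT : i < j < size T by rewrite -ltnS ij.
  (* With [a <= c] from [dec], the triple is ordered [b < a < c] when [b < a], and [a < c < b]
     otherwise. *)
  have [le_ij|lt_ij] := leqP (E i k.+1) (E j k.+1); last first.
    have -> : cell_lt T (j.+1, k.+1) (i.+1, k.+1) by rewrite /cell_lt lt_ij.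
    by rewrite !orbT.
  suff -> : E i k < E j k.+1 by [].
  case: k {le_ij} (le_ij) ki kj => [|k] le_ij ki kj; last exact: ok.
  by rewrite E1 // /E /aug_entry.
- move=> [|i] [|j] k // _ ij; rewrite !part_shape !in_shape => sij.
  move=> /andP[iT ki] /andP[jT kj]; rewrite /inversion_triple /=.
  have ijT : i < j < size T by rewrite -ltnS ij.
  by rewrite cell_lt_right // cell_lt_left // -!/(E _ _) dec // longer.
Qed.

(** * Deleting empty rows *)

Definition drop_empty (T : filling) : filling := [seq r <- T | r != [::]].

(** With [n] rows already placed, a row starting with [x] must land at height [x], whence [x - n.+1]
    empty rows before it. *)
Fixpoint insert_empty (n : nat) (U : filling) : filling :=
  if U is r :: U' then
    nseq (nth 0 r 0 - n.+1) [::] ++ r :: insert_empty (nth 0 r 0) U'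
  else [::].

Lemma shape_drop_empty (T : filling) : shape (drop_empty T) = compress (shape T).
Proof. by elim: T => //= -[|x r] T //= ->. Qed.

Lemma flatten_drop_empty (T : filling) : flatten (drop_empty T) = flatten T.
Proof. by elim: T => //= -[|x r] T //= ->. Qed.

Lemma column_drop_empty (T : filling) (v : nat) :
  column (drop_empty T) v = column T v.
Proof.
rewrite /column; congr _.+1; elim: T => //= -[|x r] T IHT //=.
by case: ifP.
Qed.

Lemma descent_composition_drop_empty (T : filling) :
  descent_composition (drop_empty T) = descent_composition T.
Proof.
rewrite /descent_composition /descents flatten_drop_empty; congr beta.
by apply: eq_filter => i; rewrite !column_drop_empty.
Qed.

Lemma basement_rows_cons (n : nat) (r : seq nat) (T : filling) :
  basement_rows n (r :: T) <->
  (r != [::] -> nth 0 r 0 = n.+1) /\ basement_rows n.+1 T.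
Proof.
split=> [H|[H1 H2]].
  split=> [r0|i iT Ti]; first by rewrite (H 0) ?addn0.
  by have := H i.+1 iT Ti; rewrite addSnnS.
by move=> [|i] iT Ti; [rewrite addn0 H1|rewrite -addSnnS -H2].
Qed.

Lemma basement_rows_gt (n : nat) (T : filling) :
  basement_rows n T -> all (fun r => n < nth 0 r 0) (drop_empty T).
Proof.
elim: T n => //= r T IHT n /basement_rows_cons[Hr /IHT HT].
have {}HT : all (fun r => n < nth 0 r 0) (drop_empty T).
  by apply: sub_all HT => s /ltnW.
by case: ifP => //= /Hr ->; rewrite leqnn.
Qed.

Lemma basement_rows_first_lt (n : nat) (T : filling) :
  basement_rows n T -> pairwise first_lt (drop_empty T).
Proof.
elim: T n => //= r T IHT n /basement_rows_cons[Hr HT].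
case: ifP => [/Hr r1|_]; last exact: IHT HT.
by rewrite pairwise_cons (IHT _ HT) andbT /first_lt r1 basement_rows_gt.
Qed.

Lemma drop_insert_empty (n : nat) (U : filling) :
  [::] \notin U -> drop_empty (insert_empty n U) = U.
Proof.
elim: U n => //= r U IHU n; rewrite in_cons negb_or eq_sym => /andP[r0 U0].
rewrite /drop_empty filter_cat /= r0 [X in _ ++ _ :: X]IHU //.
by elim: (_ - _).
Qed.

Lemma insert_empty_last (n x : nat) (U : filling) :
  [::] \notin U -> 0 < x -> 0 < last x (shape (insert_empty n U)).
Proof.
elim: U n x => //= r U IHU n x; rewrite in_cons negb_or eq_sym => /andP[r0 U0] _.
by rewrite /shape map_cat last_cat /= IHU // lt0n size_eq0.
Qed.

Lemma basement_rows_nseq (n d : nat) (T : filling) :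
  basement_rows (n + d) T -> basement_rows n (nseq d [::] ++ T).
Proof.
elim: d n => [|d IHd] n; first by rewrite addn0.
by rewrite -addSnnS => /IHd HT; apply/basement_rows_cons.
Qed.

Lemma basement_rows_insert_empty (n : nat) (U : filling) :
  all (fun r => n < nth 0 r 0) U -> pairwise first_lt U ->
  basement_rows n (insert_empty n U).
Proof.
elim: U n => [|r U IHU] n; first by move=> _ _ [].
rewrite pairwise_cons => /andP[rn _] /andP[rU /(IHU _ rU) HU].
apply: basement_rows_nseq; apply/basement_rows_cons.
by have -> : (n + (nth 0 r 0 - n.+1)).+1 = nth 0 r 0 by lia.
Qed.


Lemma all_insert_empty (P : pred (seq nat)) (n : nat) (U : filling) :
  P [::] -> all P (insert_empty n U) = all P U.
Proof.
by move=> P0; elim: U n => //= r U IHU n; rewrite all_cat all_nseq P0 orbT /= IHU.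
Qed.

Lemma row_ok_nil (r : seq nat) : row_ok r [::]. Proof. by []. Qed.

(** An empty upper row is padded by [0], below all positive entries; an empty lower row has no
    column to test. *)
Lemma row_ok_insert_empty (n : nat) (U : filling) :
  positive_entries U -> pairwise row_ok U -> pairwise row_ok (insert_empty n U).
Proof.
elim: U n => // r U IHU n /= /andP[rp Up] /andP[rU UU].
have nil_ok : all (row_ok [::]) (r :: insert_empty (nth 0 r 0) U).
  rewrite /= all_insert_empty //.
  have nilP s : all (leq 1) s -> row_ok [::] s.
    move=> /(all_nthP 0) sp; apply/row_okP => k /andP[_ ks] _.
    by rewrite nth_nil sp.
  by rewrite nilP //; apply: sub_all Up.
elim: (_ - _) => [|d IHd]; last first.
  by rewrite /= all_cat all_nseq row_ok_nil orbT nil_ok.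
by rewrite /= all_insert_empty // rU IHU.
Qed.

(** First entries determine the gaps above nonempty rows; the positive last part rules out trailing
    empty rows, which [insert_empty] never creates. *)
Lemma insert_drop_empty (n : nat) (T : filling) : basement_rows n T ->
  0 < last 1 (shape T) -> insert_empty n (drop_empty T) = T.
Proof.
elim: T n => //= r T IHT n /basement_rows_cons[Hr HT] lastT.
case: ifP => [/[dup] r0 /Hr r1|/negbFE/eqP r0] /=.
  rewrite r1 subnn IHT //.
  by case: T {IHT HT} lastT.
subst r; have {}lastT : 0 < last 1 (shape T) /\ T != [::] by case: T {IHT HT} lastT.
have := IHT n.+1 HT lastT.1; have := basement_rows_gt HT.
case: (drop_empty T) => [_ T0|r U /=]; first by rewrite -T0 in lastT; case: lastT.
by move=> /andP[nr _] <-; rewrite -(subnSK nr).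
Qed.

Definition SSAFs (a : seq nat) : set filling :=
  [set T | exists2 g, expansion a g & SSAF g T].

Lemma drop_empty_bij (a : seq nat) : is_composition a ->
  set_bij (SSAFs a) (ComT a) drop_empty.
Proof.
move=> ca; split.
- move=> T [g [lastg ga] gT]; have Tg : shape T = g by case: gT => -[].
  rewrite -Tg in ga lastg gT; have bT := SSAF_basement_rows gT.
  apply/ComTP; split; first by rewrite shape_drop_empty.
  + case: gT => -[_ posT _] _; apply/allP => r; rewrite mem_filter => /andP[_].
    exact: (allP posT).
  + apply/allP => r; rewrite mem_filter => /andP[_].
    move: r; apply/allP; apply/sorted_geq_rowsP => i k ki.
    case: gT => _ [decT _ _]; apply: (decT i.+1 k.+1).
    rewrite in_shape ki andbT ltnNge; apply/negP => iT.
    by rewrite nth_default in ki.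
  + exact: basement_rows_first_lt bT.
  + exact/pairwise_filter/SSAF_row_ok.
- move=> T T'; rewrite !inE => -[g [lastg _] gT] [g' [lastg' _] gT'] eqT.
  have Tg : shape T = g by case: gT => -[].
  have Tg' : shape T' = g' by case: gT' => -[].
  rewrite -Tg in lastg gT; rewrite -Tg' in lastg' gT'.
  rewrite -(insert_drop_empty (SSAF_basement_rows gT)) // eqT.
  by rewrite (insert_drop_empty (SSAF_basement_rows gT')).
- move=> U /ComTP[Ua posU decU fU okU].
  have U0 : [::] \notin U.
    by apply/negP => /(map_f size); rewrite -/(shape U) Ua => /(allP ca).
  have h0 : all (fun r => 0 < nth 0 r 0) U.
    apply/allP => -[|x r] rU; first by rewrite rU in U0.
    by have := allP posU _ rU; case/andP.
  exists (insert_empty 0 U); last exact: drop_insert_empty.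
  exists (shape (insert_empty 0 U)).
    by split; [exact: insert_empty_last|rewrite -shape_drop_empty drop_insert_empty].
  apply: SSAF_of_rows; rewrite /positive_entries ?all_insert_empty //.
    exact: basement_rows_insert_empty.
  exact: row_ok_insert_empty.
Qed.

(** * Standardization *)

(** A cell is kept as its entry and its column, numbered from 1 as in [column]. The row is
    forgotten, since tie-breaking and descents depend on columns only. *)
Definition tag_columns (r : seq nat) : seq (nat * nat) := zip r (iota 1 (size r)).

Definition cells (T : filling) : seq (nat * nat) :=
  flatten [seq tag_columns r | r <- T].

Definition map_cells (f : nat * nat -> nat) (T : filling) : filling :=
  [seq [seq f c | c <- tag_columns r] | r <- T].

Lemma unzip1_tag (r : seq nat) : unzip1 (tag_columns r) = r.
Proof. by rewrite unzip1_zip // size_iota. Qed.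

Lemma size_tag (r : seq nat) : size (tag_columns r) = size r.
Proof. by rewrite size_zip size_iota minnn. Qed.

Lemma nth_tag (r : seq nat) (k : nat) : k < size r ->
  nth (0, 0) (tag_columns r) k = (nth 0 r k, k.+1).
Proof. by move=> kr; rewrite nth_zip ?size_iota // nth_iota. Qed.

Lemma mem_tag (r : seq nat) (c : nat * nat) : c \in tag_columns r ->
  c.2.-1 < size r /\ c = (nth 0 r c.2.-1, c.2.-1.+1).
Proof.
move=> /(nthP (0, 0))[k]; rewrite size_tag => kr <-.
by rewrite nth_tag.
Qed.

Lemma tag_map (f : nat * nat -> nat) (r : seq nat) :
  tag_columns [seq f c | c <- tag_columns r] =
  [seq (f c, c.2) | c <- tag_columns r].
Proof.
apply: (@eq_from_nth _ (0, 0)) => [|k]; rewrite !(size_tag, size_map) // => kr.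
by rewrite nth_tag ?size_map ?size_tag // !(nth_map (0, 0)) ?size_tag // nth_tag.
Qed.

Lemma cells_map (f : nat * nat -> nat) (T : filling) :
  cells (map_cells f T) = [seq (f c, c.2) | c <- cells T].
Proof. by elim: T => //= r T IHT; rewrite /cells /= map_cat tag_map -IHT. Qed.

Lemma flatten_map_cells (f : nat * nat -> nat) (T : filling) :
  flatten (map_cells f T) = [seq f c | c <- cells T].
Proof. by elim: T => //= r T IHT; rewrite /cells /= map_cat -IHT. Qed.

Lemma unzip1_cells (T : filling) : unzip1 (cells T) = flatten T.
Proof.
elim: T => //= r T IHT.
by rewrite /cells /= /unzip1 map_cat -/unzip1 -IHT unzip1_tag.
Qed.

Lemma map_cells_comp (f g : nat * nat -> nat) (T : filling) :
  map_cells f (map_cells g T) = map_cells (fun c => f (g c, c.2)) T.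
Proof. by elim: T => //= r T ->; rewrite tag_map -map_comp. Qed.

Lemma map_cells_id_in (f : nat * nat -> nat) (T : filling) :
  {in cells T, f =1 fst} -> map_cells f T = T.
Proof.
elim: T => //= r T IHT fT; rewrite IHT => [|c cT].
  congr cons; rewrite -[RHS]unzip1_tag; apply/eq_in_map => c cr.
  by apply: fT; rewrite mem_cat cr.
by apply: fT; rewrite mem_cat cT orbT.
Qed.

Lemma shape_map_cells (f : nat * nat -> nat) (T : filling) :
  shape (map_cells f T) = shape T.
Proof. by elim: T => //= r T ->; rewrite size_map size_tag. Qed.

Lemma size_nth_map_cells (f : nat * nat -> nat) (T : filling) (i : nat) :
  size (nth [::] (map_cells f T) i) = size (nth [::] T i).
Proof. by rewrite -!part_shape shape_map_cells. Qed.

Lemma nth_map_cells (f : nat * nat -> nat) (T : filling) (i k : nat) :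
  k < size (nth [::] T i) ->
  nth 0 (nth [::] (map_cells f T) i) k = f (nth 0 (nth [::] T i) k, k.+1).
Proof.
elim: T i => [|r T IHT] [|i] //= kr.
  by rewrite (nth_map (0, 0)) ?size_tag // nth_tag.
exact: IHT.
Qed.

Lemma mem_cells (T : filling) (i k : nat) : k < size (nth [::] T i) ->
  (nth 0 (nth [::] T i) k, k.+1) \in cells T.
Proof.
move=> ki; have iT : i < size T.
  by rewrite ltnNge; apply/negP => iT; rewrite nth_default in ki.
apply/flattenP; exists (tag_columns (nth [::] T i)); first exact/map_f/mem_nth.
by rewrite -nth_tag // mem_nth // size_tag.
Qed.

Lemma mem_cells_column (T : filling) (v k : nat) :
  uniq (flatten T) -> (v, k) \in cells T -> column T v = k.
Proof.
rewrite /column; elim: T => //= r T IHT; rewrite cat_uniq => /and3P[ur rT uT].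
rewrite /cells /= mem_cat => /orP[/mem_tag /= [kr [-> ->]]|vT].
  by rewrite mem_nth //= index_uniq.
have /negPf -> /= : v \notin r; last exact: IHT.
apply: contra rT => vr; apply/hasP; exists v => //=.
by rewrite -unzip1_cells; apply/mapP; exists (v, k).
Qed.

Lemma cellsE (T : filling) : uniq (flatten T) ->
  cells T = [seq (v, column T v) | v <- flatten T].
Proof.
move=> uT; rewrite -unzip1_cells -map_comp -[LHS]map_id.
by apply/eq_in_map => -[v k] /(mem_cells_column uT) <-.
Qed.

(* Equal entries of a tableau lie in distinct columns and are standardized from
   right to left, so that no descent separates them. *)
Definition std_lt (c d : nat * nat) : bool :=
  (c.1 < d.1) || ((c.1 == d.1) && (d.2 < c.2)).

Definition std_le (c d : nat * nat) : bool :=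
  (c.1 < d.1) || ((c.1 == d.1) && (d.2 <= c.2)).

Lemma std_lt_trans : transitive std_lt.
Proof. by move=> [a b] [c d] [e f]; rewrite /std_lt /=; lia. Qed.

Lemma std_lt_irr : irreflexive std_lt.
Proof. by move=> [a b]; rewrite /std_lt /=; lia. Qed.

Lemma std_le_trans : transitive std_le.
Proof. by move=> [a b] [c d] [e f]; rewrite /std_le /=; lia. Qed.

Lemma std_le_total : total std_le.
Proof. by move=> [a b] [c d]; rewrite /std_le /=; lia. Qed.

Lemma std_le_anti : antisymmetric std_le.
Proof.
by move=> [a b] [c d]; rewrite /std_le /= => H; apply/eqP; rewrite xpair_eqE; lia.
Qed.

Lemma std_lt_neqAle (c d : nat * nat) : std_lt c d = (c != d) && std_le c d.
Proof.
by case: c d => [a b] [c d]; rewrite /std_lt /std_le xpair_eqE /=; lia.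
Qed.

Lemma index_std_lt (L : seq (nat * nat)) : sorted std_lt L ->
  {in L &, forall c d, (index c L < index d L) = std_lt c d}.
Proof.
move=> sL c d cL dL; apply/idP/idP => [|lt_cd].
  exact: (sorted_ltn_index std_lt_trans sL).
rewrite ltnNge leq_eqVlt; apply/negP => /orP[/eqP e|].
  by move: lt_cd; rewrite -(nth_index d cL) -e nth_index // std_lt_irr.
move=> /(sorted_ltn_index std_lt_trans sL _ _ dL cL) /(std_lt_trans lt_cd).
by rewrite std_lt_irr.
Qed.

Lemma sorted_std_lt_sort (s : seq (nat * nat)) :
  uniq s -> sorted std_lt (sort std_le s).
Proof.
move=> us; have := sort_sorted std_le_total s.
rewrite (sorted_pairwise std_le_trans) (sorted_pairwise std_lt_trans) => ps.
have := us; rewrite -(sort_uniq std_le) uniq_pairwise => pu.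
have pI : pairwise [rel c d | (c != d) && std_le c d] (sort std_le s).
  by rewrite (pairwise_relI [rel c d | c != d]) pu ps.
by apply: sub_pairwise pI => c d; rewrite std_lt_neqAle.
Qed.

(* Each defining condition of [ComT] compares two entries in a way that is
   insensitive to breaking ties from right to left. *)
Lemma ComT_map_cells (a : seq nat) (f : nat * nat -> nat) (T : filling) :
  positive_entries T -> {in cells T, forall c, 0 < f c} ->
  {in cells T &, forall c d, (f c < f d) = std_lt c d} ->
  ComT a (map_cells f T) <-> ComT a T.
Proof.
move=> posT f0 ff.
have posfT : positive_entries (map_cells f T).
  apply/positive_entriesP => i k; rewrite size_nth_map_cells => ki.
  by rewrite nth_map_cells // f0 // mem_cells.
have sT : size (map_cells f T) = size T by rewrite size_map.
have decE : all (sorted geq) (map_cells f T) = all (sorted geq) T.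
  apply/sorted_geq_rowsP/sorted_geq_rowsP => H i k ki; have ki' := ltnW ki.
    have := H i k; rewrite size_nth_map_cells !nth_map_cells // => /(_ ki).
    by rewrite leqNgt ff ?mem_cells // /std_lt /=; lia.
  rewrite size_nth_map_cells in ki ki'.
  rewrite !nth_map_cells // leqNgt ff ?mem_cells //.
  by have := H i k ki; rewrite /std_lt /=; lia.
have firstE i j :
    first_lt (nth [::] (map_cells f T) i) (nth [::] (map_cells f T) j) =
    first_lt (nth [::] T i) (nth [::] T j).
  rewrite /first_lt.
  have [/size0nil j0|j0] := posnP (size (nth [::] T j)).
    by rewrite [in RHS]j0 [nth [::] (map_cells f T) j]size0nil ?size_nth_map_cells ?j0.
  have [/size0nil i0|i0] := posnP (size (nth [::] T i)).
    rewrite [in RHS]i0 [nth [::] (map_cells f T) i]size0nil ?size_nth_map_cells ?i0 //=.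
    by rewrite !(positive_entriesP _ _) ?size_nth_map_cells.
  by rewrite !nth_map_cells // ff ?mem_cells // /std_lt /=; lia.
have okE i j : row_ok (nth [::] (map_cells f T) i) (nth [::] (map_cells f T) j) =
    row_ok (nth [::] T i) (nth [::] T j).
  rewrite /row_ok size_nth_map_cells; apply: eq_in_all => -[|k]; first by rewrite mem_iota.
  rewrite mem_iota => kj; have {}kj : k.+1 < size (nth [::] T j) by lia.
  rewrite [k.+1.-1]/=.
  have [ki|ki] := leqP (size (nth [::] T i)) k.
    rewrite ![nth 0 (nth _ _ i) _]nth_default ?size_nth_map_cells //; try lia.
    by rewrite !(positive_entriesP _ _) ?size_nth_map_cells.
  (* The premise compares cells of one column, where [std_lt] sees only the entries. In the
     conclusion the first cell is further left, so a tie does not make it smaller. *)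
  rewrite !(nth_map_cells _ kj) !(nth_map_cells _ ki); congr (_ ==> _).
    have [ki'|ki'] := leqP (size (nth [::] T i)) k.+1.
      by rewrite ![nth 0 (nth _ _ i) _]nth_default ?size_nth_map_cells.
    rewrite nth_map_cells // leqNgt ff ?mem_cells // /std_lt /=; lia.
  by rewrite ff ?mem_cells // /std_lt /=; lia.
have pwE r : (forall i j, r (nth [::] (map_cells f T) i) (nth [::] (map_cells f T) j) =
    r (nth [::] T i) (nth [::] T j)) -> pairwise r (map_cells f T) = pairwise r T.
  move=> rE; apply/(pairwiseP [::])/(pairwiseP [::]) => H i j iT jT ij.
    by rewrite -rE; apply: H; rewrite ?inE ?sT.
  by rewrite rE; apply: H; rewrite // inE -sT.
by split=> /ComTP H; apply/ComTP; move: H;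
  rewrite shape_map_cells decE !pwE // => -[? _ ? ? ?]; split.
Qed.

(** Equal entries in one column are impossible: the first column increases strictly, and elsewhere
    the triple rule would make the entry left of the upper one smaller than it, against the decrease
    of rows. *)
Lemma ComT_uniq_cells (a : seq nat) (T : filling) : ComT a T -> uniq (cells T).
Proof.
move=> /ComTP[_ posT decT fT okT]; move: posT decT fT okT.
elim: T {a} => //= r T IHT /andP[pr pT] /andP[dr dT] /andP[fr fT] /andP[okr okT].
have ur : uniq (tag_columns r).
  by apply: (@map_uniq _ _ snd); rewrite -/unzip2 unzip2_zip ?size_iota ?iota_uniq.
rewrite /cells /= cat_uniq IHT // andbT ur /=.
apply/hasPn => c /flattenP[_ /mapP[r' r'T ->] /mem_tag[cr' ec]].
apply/negP; rewrite {1}ec => /mem_tag[/= cr [e]].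
move/allP: fr => /(_ r' r'T); move/allP: okr => /(_ r' r'T) /row_okP /(_ c.2.-1).
rewrite /first_lt; case: c.2.-1 {ec} cr cr' e => [|k] cr cr' e.
  by move=> _; rewrite e ltnn.
rewrite cr' e leqnn => /(_ isT isT) /=.
by have := sortedP 0 dr k cr; rewrite /geq /=; lia.
Qed.

(** * Standardization of tableaux and its inverse *)

Definition standardize (T : filling) : filling :=
  map_cells (fun c => (index c (sort std_le (cells T))).+1) T.

Definition destandardize (w : seq nat) (S : filling) : filling :=
  map_cells (fun c => nth 0 w c.1.-1) S.

Lemma map_index_uniq (T : eqType) (s : seq T) : uniq s ->
  [seq (index x s).+1 | x <- s] = iota 1 (size s).
Proof.
case: s => // x0 s us; apply: (@eq_from_nth _ 0); rewrite size_map ?size_iota // => i ilt.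
by rewrite (nth_map x0) // index_uniq // nth_iota.
Qed.

Lemma ComT_standardize (a : seq nat) (T : filling) :
  positive_entries T -> uniq (cells T) -> ComT a (standardize T) <-> ComT a T.
Proof.
move=> posT uT; apply: ComT_map_cells => // c d cT dT; rewrite ltnS.
by rewrite index_std_lt ?mem_sort // sorted_std_lt_sort.
Qed.

Lemma flatten_standardize (T : filling) : uniq (cells T) ->
  perm_eq (flatten (standardize T)) (iota 1 (size (flatten T))).
Proof.
move=> uT; rewrite flatten_map_cells -unzip1_cells size_map.
rewrite -(size_sort std_le) -map_index_uniq ?sort_uniq //.
by apply: perm_map; rewrite perm_sym perm_sort.
Qed.

(** [std_le] refines the order on entries, so sorting the cells also sorts their entries. *)
Lemma sort_cells_values (w : seq nat) (T : filling) : sorted leq w ->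
  perm_eq (flatten T) w -> unzip1 (sort std_le (cells T)) = w.
Proof.
move=> sw Tw; apply: (sorted_eq leq_trans anti_leq) => //.
  apply: (homo_sorted (e := std_le)); last exact: sort_sorted std_le_total _.
  by move=> [a b] [c d]; rewrite /std_le /=; lia.
apply: perm_trans Tw; rewrite -unzip1_cells.
by apply: perm_map; rewrite perm_sort.
Qed.

Lemma standardizeK (w : seq nat) (T : filling) : sorted leq w ->
  perm_eq (flatten T) w -> destandardize w (standardize T) = T.
Proof.
move=> sw Tw; rewrite /destandardize map_cells_comp /=.
apply: map_cells_id_in => c cT /=; rewrite -(sort_cells_values sw Tw).
by rewrite (nth_map (0, 0)) ?index_mem ?nth_index ?mem_sort.
Qed.

(** Positions [p] and [p + 1] of the word, counted from 1, have indices [p.-1] and [p]. *)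
Definition increases_at (w s : seq nat) : Prop :=
  forall p, p \in s -> nth 0 w p.-1 < nth 0 w p.

(** Consecutive sorted cells are related by [std_lt]. At a descent the second one is not strictly to
    the left, which excludes a tie of entries. *)
Lemma standardize_descents (w : seq nat) (T : filling) : uniq (cells T) ->
  sorted leq w -> perm_eq (flatten T) w ->
  increases_at w (descents (standardize T)).
Proof.
move=> uT sw Tw p; rewrite mem_filter mem_iota.
have pS := flatten_standardize uT; rewrite (perm_size pS) size_iota.
set L := sort std_le (cells T); have uL : uniq L by rewrite sort_uniq.
have sL : size L = size (flatten T) by rewrite -unzip1_cells size_map size_sort.
(* The cell of index [q] in [L] receives the entry [q.+1]. *)
have colE q : q < size L -> column (standardize T) q.+1 = (nth (0, 0) L q).2.
  move=> qL; apply: mem_cells_column; first by rewrite (perm_uniq pS) iota_uniq.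
  rewrite cells_map; apply/mapP; exists (nth (0, 0) L q).
    by rewrite -(mem_sort std_le) mem_nth.
  by rewrite index_uniq.
move=> /andP[desc /andP[p0 pN]]; have {}pN : p < size L by rewrite sL; lia.
case: p p0 pN desc => // p _ pN; rewrite !colE // => [desc|]; last exact: ltnW.
have := sortedP (0, 0) (sorted_std_lt_sort uT) p pN; rewrite -/L.
rewrite -(sort_cells_values sw Tw) -/L !(nth_map (0, 0)) //; last exact: ltnW.
by rewrite /std_lt (negPf desc) andbF orbF.
Qed.

(** [L] lists the new cells in the order of their standard entries. Where [w] repeats a letter there
    is no descent, so the next cell lies strictly to the left, exactly as [std_lt] demands for a
    tie. *)
Lemma sort_cells_destandardize (w : seq nat) (S : filling) : sorted leq w ->
  perm_eq (flatten S) (iota 1 (size w)) -> increases_at w (descents S) ->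
  let L := [seq (nth 0 w p.-1, column S p) | p <- iota 1 (size w)] in
  sorted std_lt L /\ sort std_le (cells (destandardize w S)) = L.
Proof.
move=> sw Sw incw L; have uS : uniq (flatten S) by rewrite (perm_uniq Sw) iota_uniq.
have sL : sorted std_lt L.
  apply/(sortedP (0, 0)) => p; rewrite size_map size_iota => pw.
  rewrite !(nth_map 0) ?size_iota ?(ltnW pw) // !nth_iota ?(ltnW pw) //.
  rewrite /std_lt /= !add1n /=; have := sortedP 0 sw p pw.
  rewrite leq_eqVlt => /orP[/eqP e|->//]; rewrite e ltnn eqxx /=.
  apply: contraTT isT => ndesc; have := incw p.+1; rewrite mem_filter ndesc /= mem_iota.
  by rewrite (perm_size Sw) size_iota e ltnn => H; suff: false by []; apply: H; lia.
split=> //; rewrite -(sorted_sort std_le_trans (s := L)); last first.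
  by apply: sub_sorted sL => c d; rewrite std_lt_neqAle => /andP[].
apply/(perm_sortP std_le_total std_le_trans std_le_anti).
rewrite cells_map cellsE // -map_comp /L.
exact: perm_map Sw.
Qed.

Lemma destandardizeK (w : seq nat) (S : filling) : sorted leq w ->
  perm_eq (flatten S) (iota 1 (size w)) -> increases_at w (descents S) ->
  standardize (destandardize w S) = S.
Proof.
move=> sw Sw incw; have [sL LE] := sort_cells_destandardize sw Sw incw.
have uS : uniq (flatten S) by rewrite (perm_uniq Sw) iota_uniq.
rewrite /standardize LE {1}/destandardize map_cells_comp /=.
apply: map_cells_id_in => -[p k] pk /=; rewrite -(mem_cells_column uS pk).
have : p \in flatten S by rewrite -unzip1_cells; apply/mapP; exists (p, k).
rewrite (perm_mem Sw) mem_iota => pw; have pw' : p.-1 < size w by lia.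
set L := [seq _ | p <- _] in sL *.
have -> : (nth 0 w p.-1, column S p) = nth (0, 0) L p.-1.
  by rewrite (nth_map 0) ?size_iota // nth_iota // add1n prednK //; lia.
rewrite index_uniq ?size_map ?size_iota ?(sorted_uniq std_lt_trans std_lt_irr) //.
by rewrite prednK //; lia.
Qed.

Lemma positive_entriesE (T : filling) : positive_entries T = all (leq 1) (flatten T).
Proof. by elim: T => //= r T IHT; rewrite all_cat -IHT. Qed.

Lemma destandardize_bij (a w : seq nat) : sorted leq w -> all (leq 1) w ->
  set_bij [set S | [/\ standard_ComT a S, sumn a = size w
                     & increases_at w (descents S)]]
          [set T | ComT a T /\ perm_eq (flatten T) w] (destandardize w).
Proof.
move=> sw w0; split.
- move=> S [[aS Sa] aw incw]; rewrite aw in Sa.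
  have Dw : perm_eq (flatten (destandardize w S)) w.
    rewrite flatten_map_cells
      (_ : [seq _ | c <- _] = [seq nth 0 w p.-1 | p <- unzip1 (cells S)]).
      rewrite unzip1_cells; apply: (perm_trans (perm_map _ Sa)).
      suff -> : [seq nth 0 w p.-1 | p <- iota 1 (size w)] = w by [].
      apply: (@eq_from_nth _ 0) => [|p]; rewrite size_map size_iota // => pw.
      by rewrite (nth_map 0) ?size_iota // nth_iota.
    by rewrite -map_comp.
  split=> //; apply/(@ComT_standardize a (destandardize w S)); last 1 first.
  + by rewrite destandardizeK.
  + by rewrite positive_entriesE (perm_all _ Dw).
  (* [ComT_uniq_cells] would presuppose the goal; distinctness comes instead from the strict sorting
     of the cells. *)
  + have [sL LE] := sort_cells_destandardize sw Sa incw.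
    by rewrite -(sort_uniq std_le) LE (sorted_uniq std_lt_trans std_lt_irr).
- move=> S S'; rewrite !inE => -[[_ Sa] aw incw] [[_ Sa'] _ incw'] eqS.
  by rewrite -(@destandardizeK w S) ?eqS ?destandardizeK -?aw.
- move=> T [aT Tw]; have uT := ComT_uniq_cells aT.
  have [Ta posT _ _ _] := aT; exists (standardize T); last exact: standardizeK.
  have szT : size (flatten T) = sumn a by rewrite size_flatten Ta.
  split; last exact: standardize_descents.
    split; first by apply/ComT_standardize.
    by rewrite -szT flatten_standardize.
  by rewrite -szT (perm_size Tw).
Qed.

(** * Coefficients of fundamental quasisymmetric functions *)

(** The initial [0] is omitted and the total is included. *)
Notation psums := (scanl addn 0).

Lemma scanl_addn (x : nat) (s : seq nat) : scanl addn x s = map (addn x) (psums s).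
Proof.
elim: s x => //= y s IHs x; rewrite add0n IHs [in RHS](IHs y) -map_comp.
by congr cons; apply: eq_map => z /=; rewrite addnA.
Qed.

Lemma psums_cons (x : nat) (s : seq nat) : psums (x :: s) = x :: map (addn x) (psums s).
Proof. by rewrite /= add0n (scanl_addn x). Qed.

Lemma foldl_addn (x : nat) (s : seq nat) : foldl addn x s = x + sumn s.
Proof. by elim: s x => [|y s IHs] x /=; rewrite ?addn0 // IHs addnA. Qed.

Lemma psums_cat (s t : seq nat) :
  psums (s ++ t) = psums s ++ map (addn (sumn s)) (psums t).
Proof. by rewrite scanl_cat foldl_addn add0n (scanl_addn (sumn s)). Qed.

Lemma mem_psums_le (s : seq nat) (y : nat) : y \in psums s -> y <= sumn s.
Proof.
elim: s y => // x s IHs y; rewrite psums_cons in_cons => /orP[/eqP->|].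
  exact: leq_addr.
by move=> /mapP[z /IHs zs ->]; rewrite /= leq_add2l.
Qed.

Lemma mem_psums_gt0 (s : seq nat) (y : nat) :
  is_composition s -> y \in psums s -> 0 < y.
Proof.
case: s => // x s /andP[x0 _]; rewrite psums_cons in_cons => /orP[/eqP->//|].
by move=> /mapP[z _ ->]; rewrite addn_gt0 x0.
Qed.

Lemma sumn_psums (s : seq nat) : s != [::] -> sumn s \in psums s.
Proof.
case/lastP: s => // s x _; rewrite scanl_rcons foldl_addn add0n.
by rewrite mem_rcons mem_head.
Qed.

Lemma sumn_flatten_map (bs : seq (seq nat)) : sumn (flatten bs) = sumn (map sumn bs).
Proof. by elim: bs => //= s bs IHbs; rewrite sumn_cat IHbs. Qed.

(** Conversely to the evident inclusion, the first part [x] of [a] is a partial sum of [b], so a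
    prefix of [b] forms the first block; the remaining parts are treated by induction, with partial
    sums shifted by [x]. *)
Lemma coarseningP (a b : seq nat) : is_composition a -> is_composition b ->
  coarsening a b <-> sumn a = sumn b /\ {subset psums a <= psums b}.
Proof.
move=> ca cb; split=> [[bs [nbs <- <-]]|].
  split; first by rewrite sumn_flatten_map.
  elim: bs nbs {ca cb} => // s bs IHbs; rewrite in_cons negb_or eq_sym => /andP[s0 nbs] y.
  rewrite [flatten _]/= [map _ _]/= psums_cons psums_cat in_cons mem_cat.
  move=> /orP[/eqP ->|]; first by rewrite sumn_psums.
  by move=> /mapP[z /(IHbs nbs) zb ->]; rewrite map_f ?orbT.
elim: a b ca cb => [|x a IHa] b /=.
  move=> _ cb [sb _]; exists [::]; split=> //.
  by case: b cb sb => //= y b; case: y.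
move=> /andP[x0 ca] cb [sab sub].
have := sub x; rewrite -/(psums (x :: a)) psums_cons mem_head => /(_ isT).
move=> /(nthP 0)[k]; rewrite size_scanl => kb.
rewrite nth_scanl // foldl_addn add0n => xk.
rewrite -(cat_take_drop k.+1 b) sumn_cat xk in sab *.
have cbd : is_composition (drop k.+1 b).
  by apply/allP => y /mem_drop /(allP cb).
have [|bs [nbs bsb bsa]] := IHa (drop k.+1 b) ca cbd.
  split; first exact: (addnI sab).
  move=> y ya; have y0 := mem_psums_gt0 ca ya.
  have := sub (x + y); rewrite -/(psums (x :: a)) psums_cons.
  rewrite in_cons (map_f _ ya) orbT => /(_ isT).
  (* Partial sums of the prefix are at most [x], hence smaller than [x + y]. *)
  rewrite -{1}(cat_take_drop k.+1 b) psums_cat mem_cat xk => /orP[|].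
    by move=> /mem_psums_le; rewrite xk -{2}(addn0 x) leq_add2l leqNgt y0.
  by move=> /mapP[z zb /addnI ->].
exists (take k.+1 b :: bs); split; rewrite /= ?xk ?bsb ?bsa //.
rewrite in_cons negb_or nbs andbT eq_sym -size_eq0 size_take; case: ifP => //.
by move=> /negbT; case: (b) kb.
Qed.

(** For increasing [i] this is the sorted word of the monomial [M_term c i]. *)
Definition word (i c : seq nat) : seq nat :=
  flatten [seq nseq p.2 p.1 | p <- zip i c].

Lemma size_word (i c : seq nat) : size i = size c -> size (word i c) = sumn c.
Proof.
elim: i c => [|y i IHi] [|q c] //= [ic].
by rewrite /word /= size_cat size_nseq -IHi.
Qed.

Lemma mem_word (i c : seq nat) (x : nat) : x \in word i c -> x \in i.
Proof.
move=> /flattenP[_ /mapP[[y q] yq ->]]; rewrite mem_nseq => /andP[_ /eqP->] /=.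
elim: i c yq => [|z i IHi] [|r c] //=; rewrite !in_cons => /orP[/eqP[-> _]|/IHi ->].
  by rewrite eqxx.
by rewrite orbT.
Qed.

Lemma sorted_word (i c : seq nat) : sorted ltn i -> sorted leq (word i c).
Proof.
rewrite (sorted_pairwise ltn_trans) (sorted_pairwise leq_trans).
elim: i c => [|y i IHi] [|q c] //= /andP[yi si].
rewrite /word /= pairwise_cat -/(word i c) IHi // andbT; apply/andP; split.
  apply/allrelP => x z; rewrite mem_nseq => /andP[_ /eqP->] /mem_word zi.
  exact/ltnW/(allP yi).
by elim: q => //= q ->; rewrite all_nseq leqnn orbT.
Qed.

Lemma count_word (i c : seq nat) (x : nat) :
  count_mem x (word i c) = M_term c i x.
Proof.
rewrite /M_term /word; elim: (zip i c) => [|[y q] s IHs] /=.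
  by rewrite big_nil mset0E.
rewrite big_cons count_cat IHs msetE2 msetnE count_nseq /= eq_sym.
by case: eqP; rewrite ?mul1n.
Qed.

(* The cut points of the exponent composition of a word are its strict ascents. *)
Lemma mem_psums_word (i c : seq nat) (p : nat) : sorted ltn i ->
  is_composition c -> size i = size c -> 0 < p < sumn c ->
  (p \in psums c) = (nth 0 (word i c) p.-1 < nth 0 (word i c) p).
Proof.
rewrite (sorted_pairwise ltn_trans).
elim: i c p => [|y i IHi] [|q c] p //=; first by rewrite ltn0 andbF.
move=> /andP[yi si] /andP[q0 cc] [ic] /andP[p0 pqc].
rewrite -/(psums (q :: c)) psums_cons in_cons /word /= -/(word i c) !nth_cat !size_nseq.
(* Strictly inside the first block the word is constant; after it the induction hypothesis applies
   with a shift by [q]; at its end the next letter comes from [i] and exceeds [y]. *)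
have [pq|qp|epq] := ltngtP p q.
- rewrite (leq_ltn_trans (leq_pred p) pq) !nth_nseq pq (leq_ltn_trans (leq_pred p) pq).
  by rewrite ltnn; apply/negbTE/mapP => -[z _ ez]; rewrite ez ltnNge leq_addr in pq.
- have -> : (p.-1 < q) = false by lia.
  have -> : p.-1 - q = (p - q).-1 by lia.
  rewrite -IHi //; last by lia.
  by rewrite -{1}(subnKC (ltnW qp)) mem_map //; apply: addnI.
- subst p; rewrite subnn prednK // leqnn nth_nseq prednK // leqnn /=; apply/esym.
  have : 0 < size (word i c) by rewrite size_word //; lia.
  by move=> /(mem_nth 0) /mem_word; apply: (allP yi).
Qed.

(** * Supports, exponents and coefficients of [qsym_M] and [qsym_F] *)

Definition supp (m : monomial) : seq nat := sort leq (undup m).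

Definition exps (m : monomial) : seq nat := [seq m x | x <- supp m].

Lemma mem_supp (m : monomial) (x : nat) : (x \in supp m) = (x \in m).
Proof. by rewrite mem_sort mem_undup. Qed.

Lemma sorted_supp (m : monomial) : sorted ltn (supp m).
Proof.
by rewrite ltn_sorted_uniq_leq sort_uniq undup_uniq sort_sorted //; apply: leq_total.
Qed.

Lemma M_termE (c i : seq nat) (x : nat) : size i = size c -> uniq i ->
  M_term c i x = nth 0 c (index x i).
Proof.
rewrite /M_term; elim: i c => [|y i IHi] [|q c] //=.
  by rewrite big_nil mset0E.
move=> [ic] /andP[yi ui]; rewrite big_cons msetE2 msetnE IHi // eq_sym.
case: eqP => [<-|//]; rewrite nth_default ?addn0 //.
by rewrite -ic memNindex.
Qed.

Lemma M_term_exps (m : monomial) : M_term (exps m) (supp m) = m.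
Proof.
have us : uniq (supp m) by rewrite sort_uniq undup_uniq.
apply/msetP => x; rewrite M_termE ?size_map //.
have [xm|xm] := boolP (x \in supp m).
  by rewrite (nth_map 0) ?index_mem // nth_index.
rewrite nth_default ?size_map ?memNindex //.
by apply/esym/mset_eq0P; rewrite -mem_supp.
Qed.

Lemma sort_word (m : monomial) : sort leq m = word (supp m) (exps m).
Proof.
apply: (sorted_eq leq_trans anti_leq); first exact/sort_sorted/leq_total.
  exact/sorted_word/sorted_supp.
rewrite perm_sort; apply/allP => x _ /=.
by rewrite count_word M_term_exps count_mem_mset.
Qed.

Lemma exps_composition (m : monomial) : is_composition (exps m).
Proof. by apply/allP => _ /mapP[x xm ->]; rewrite -in_mset -mem_supp. Qed.

Lemma sumn_exps (m : monomial) : sumn (exps m) = size m.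
Proof. by rewrite -(size_sort leq) sort_word size_word // size_map. Qed.

(** Positive exponents make every variable of [i] occur, so the monomial recovers both lists. *)
Lemma M_term_eq (c i : seq nat) : is_composition c -> size i = size c ->
  sorted ltn i -> i = supp (M_term c i) /\ c = exps (M_term c i).
Proof.
move=> cc ic si; have ui := sorted_uniq ltn_trans ltnn si.
have iE : i = supp (M_term c i).
  apply: (irr_sorted_eq ltn_trans ltnn) => // [|x]; first exact: sorted_supp.
  rewrite mem_supp in_mset M_termE // -index_mem ic.
  have [ci|ic'] := leqP (size c) (index x i); first by rewrite nth_default.
  by apply/esym/(allP cc)/mem_nth.
split=> //; rewrite /exps -iE; apply: (@eq_from_nth _ 0); rewrite ?size_map // => k kc.
by rewrite (nth_map 0) ?ic // M_termE // index_uniq ?ic.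
Qed.

(** Only the index [supp m] can contribute, and it is admissible only if [x_0] does not divide
    [m]. *)
Lemma qsym_M_coef (c : seq nat) (m : monomial) : is_composition c ->
  qsym_M c m = ((0%N \notin m) && (c == exps m))%:R%R.
Proof.
move=> cc; have [/andP[m0 /eqP cE]|ncm] := boolP (_ && _); last first.
  apply: fsbig1 => i [ic i0 si]; rewrite /mono; case: eqP => // mE.
  have [iE cE] := M_term_eq cc ic si; case/negP: ncm.
  rewrite mE -cE eqxx andbT -mem_supp -iE; apply/negP => /(allP i0).
  by [].
rewrite /qsym_M /psum -(@fsbig_widen _ _ _ _ [set supp m]).
- by rewrite fsbig_set1 cE /mono M_term_exps eqxx.
- move=> _ ->; split; rewrite ?sorted_supp ?cE ?size_map //.
  apply/allP => x; rewrite mem_supp => xm; rewrite lt0n.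
  by apply: contraNneq m0 => x0; rewrite -x0.
- move=> i [[ic _ si] /= ni]; rewrite /mono; case: eqP => // mE; case: ni.
  by rewrite mE; case: (M_term_eq cc ic si).
Qed.

Lemma qsym_F_coef (b : seq nat) (m : monomial) :
  qsym_F b m = ((0%N \notin m) && `[< coarsening b (exps m) >])%:R%R.
Proof.
have cm := exps_composition m.
have [/andP[m0 /asboolP bm]|nbm] := boolP (_ && _); last first.
  apply: fsbig1 => c [cc bc]; rewrite qsym_M_coef //; case: eqP => [cE|]; last first.
    by rewrite andbF.
  by case: (boolP (0 \in m)) nbm => //= m0 /asboolP; rewrite -cE.
rewrite /qsym_F /psum -(@fsbig_widen _ _ _ _ [set exps m]).
- by rewrite fsbig_set1 qsym_M_coef // m0 eqxx.
- by move=> _ ->.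
- move=> c [[cc bc] /= nc]; rewrite qsym_M_coef //; case: eqP => //.
  by rewrite andbF.
Qed.

(** * Descent compositions and coarsening *)

Lemma psums_pairmap (x : nat) (s : seq nat) : path ltn x s ->
  scanl addn x (pairmap (fun x y => y - x) x s) = s.
Proof. by elim: s x => //= y s IHs x /andP[xy ys]; rewrite subnKC ?IHs // ltnW. Qed.

Lemma sumn_pairmap (x : nat) (s : seq nat) : path ltn x s ->
  x + sumn (pairmap (fun x y => y - x) x s) = last x s.
Proof.
elim: s x => [|y s IHs] x /=; first by rewrite addn0.
by move=> /andP[xy /IHs <-]; rewrite addnA subnKC // ltnW.
Qed.

Lemma pairmap_composition (x : nat) (s : seq nat) : path ltn x s ->
  is_composition (pairmap (fun x y => y - x) x s).
Proof. by elim: s x => //= y s IHs x /andP[xy /IHs ->]; rewrite subn_gt0 xy. Qed.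

Lemma path_descents (T : filling) : 0 < size (flatten T) ->
  path ltn 0 (rcons (descents T) (size (flatten T))).
Proof.
move=> T0; rewrite (path_pairwise ltn_trans) -cats1 -cat_cons pairwise_cat /= andbT.
apply/and3P; split.
- apply/allrelP => x y; rewrite in_cons mem_seq1 => + /eqP->.
  by move=> /orP[/eqP->//|]; rewrite mem_filter mem_iota; lia.
- by apply/allP => x; rewrite mem_filter mem_iota; lia.
- rewrite -(sorted_pairwise ltn_trans); apply: sorted_filter ltn_trans _ _ _.
  exact: iota_ltn_sorted.
Qed.

Lemma descent_composition_composition (T : filling) :
  is_composition (descent_composition T).
Proof.
rewrite /descent_composition /beta; case: posnP => // T0.
exact/pairmap_composition/path_descents.
Qed.

(** For nonempty [T], the partial sums of its descent composition are its descents followed by its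
    size. [coarseningP] asks that they be cut points of [exps m], and [mem_psums_word] reads these
    as strict ascents of the sorted word. *)
Lemma coarsening_descents (T : filling) (m : monomial) :
  coarsening (descent_composition T) (exps m) <->
  size (flatten T) = size m /\ increases_at (sort leq m) (descents T).
Proof.
rewrite coarseningP ?exps_composition ?descent_composition_composition //.
rewrite sumn_exps /descent_composition /beta; case: posnP => [T0|T0].
  by rewrite T0; split=> -[mT _]; split=> // p; rewrite /descents T0.
have pT := path_descents T0.
rewrite psums_pairmap // -[sumn _]add0n sumn_pairmap // last_rcons.
have iE p : size (flatten T) = size m -> p \in descents T ->
    (p \in psums (exps m)) = (nth 0 (sort leq m) p.-1 < nth 0 (sort leq m) p).
  move=> Tm; rewrite mem_filter mem_iota => pD.
  rewrite sort_word; apply: mem_psums_word;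
    rewrite ?sorted_supp ?exps_composition ?size_map //.
  by rewrite sumn_exps -Tm; lia.
split=> -[Tm H]; split=> // p.
  by move=> pD; rewrite -iE //; apply: H; rewrite mem_rcons in_cons pD orbT.
rewrite mem_rcons in_cons => /orP[/eqP->|pD]; last by rewrite iE // H.
rewrite Tm -sumn_exps; apply: sumn_psums; apply: contraTneq T0 => e.
by rewrite Tm -sumn_exps e.
Qed.

(** * Counting *)

Lemma fsum_const (I : choiceType) (X : set I) (c : int) : finite_set X ->
  (\sum_(x \in X) c = c *+ #|` fset_set X|%fset)%R.
Proof.
by move=> fX; rewrite fsbig_finite //= big_const_seq count_predT iter_addr_0.
Qed.

(** Double counting. The possibly infinite [A] is first cut down to the image of [X], off which the
    fibers are empty, so that two finite sums are exchanged. *)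
Lemma fsum_fiber (I J : choiceType) (A : set J) (X : set I) (f : I -> J)
    (c : J -> int) : finite_set X -> X `<=` f @^-1` A ->
  (\sum_(j \in A) c j *+ #|` fset_set (X `&` f @^-1` [set j])|%fset =
   \sum_(x \in X) c (f x))%R.
Proof.
move=> fX XA; rewrite -(@fsbig_widen _ _ _ _ (f @` X)) /=; first last.
- move=> j [_ nXj]; rewrite /= (_ : X `&` _ = set0) ?fset_set0 ?cardfs0 //.
  by apply/seteqP; split=> // x [Xx fx]; apply: nXj; exists x.
- by move=> _ [x Xx <-]; apply: XA.
transitivity (\sum_(j \in f @` X) \sum_(x \in X)
    if x \in f @^-1` [set j] then c j else 0)%R.
  apply: eq_fsbigr => j _; rewrite -fsbig_mkcondr fsum_const //.
  exact: finite_setIl.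
rewrite exchange_fsbig //; last exact: finite_image.
apply: eq_fsbigr => x; rewrite inE => Xx.
rewrite -(@fsbig_widen _ _ _ _ [set f x]).
- by rewrite fsbig_set1 ifT // inE.
- by move=> _ ->; exists x.
- by move=> j [_ /= nj]; rewrite ifF //; apply/negbTE/negP; rewrite inE => /esym.
Qed.

Lemma set_bij_setI (I J : Type) (A P : set I) (B Q : set J) (f : I -> J) :
  set_bij A B f -> (forall x, A x -> P x <-> Q (f x)) ->
  set_bij (A `&` P) (B `&` Q) f.
Proof.
move=> [fAB fi fs] PQ; split.
- by move=> x [Ax Px]; split; [exact: fAB|apply/PQ].
- by move=> x y; rewrite !inE => -[Ax _] [Ay _]; apply: fi; rewrite inE.
- move=> y [By Qy]; have [x Ax fx] := fs _ By; exists x => //.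
  by split=> //; apply/PQ; rewrite ?fx.
Qed.

Lemma card_set_bij (I J : choiceType) (A : set I) (B : set J) (f : I -> J) :
  finite_set A -> finite_set B -> set_bij A B f ->
  #|` fset_set A|%fset = #|` fset_set B|%fset.
Proof.
move=> fA fB fAB; have : (\sum_(y \in B) (1 : int) = \sum_(x \in A) (1 : int))%R.
  exact: (reindex_fsbig f A B (fun=> 1%R) fAB).
by rewrite !fsum_const // => /eqP; rewrite Num.Theory.eqr_nat => /eqP.
Qed.

(** * Coefficients of [quasi_schur] as numbers of tableaux *)

Lemma finite_SSAFs_content (a : seq nat) (m : monomial) :
  finite_set (SSAFs a `&` [set T | m = content T]).
Proof.
apply: (sub_finite_set _ (finite_fillings m (finite_expansions a m))).
move=> T [[g ag gT] /content_perm Tm]; have Tg : shape T = g by case: gT => -[].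
by rewrite /= Tg; split=> //; split=> //; exists T.
Qed.

Lemma quasi_schur_coef (a : seq nat) (m : monomial) :
  quasi_schur a m = (\sum_(T \in SSAFs a `&` [set T | m = content T]) (1 : int))%R.
Proof.
have fX := finite_SSAFs_content a m.
(* The fillings are grouped by shape, to match the sum of the [dem_atom g]. *)
rewrite -(@fsum_fiber _ _ (expansion a) _ shape (fun=> 1%R)) //; last first.
  move=> T [[g ag gT] _] /=.
  by have -> : shape T = g by case: gT => -[].
rewrite /quasi_schur /psum; apply: eq_fsbigr => g; rewrite inE => ag.
rewrite /dem_atom /psum.
rewrite -fsum_const; last exact: finite_setIl.
transitivity (\sum_(T \in SSAF g `&` [set T | m = content T]) (1 : int))%R.
  rewrite [RHS]fsbig_mkcondr; apply: eq_fsbigr => T _; rewrite /mono.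
  case: eqP => [mT|mT]; first by rewrite ifT // inE.
  by rewrite ifF //; apply/negbTE/negP; rewrite inE.
apply: eq_fsbigl; apply/seteqP; split=> T /=.
  by move=> [gT mT]; split; [split=> //; exists g|case: gT => -[]].
move=> [[[g' _ gT] mT] Tg]; split=> //.
by have <- : g' = g by rewrite -Tg; case: gT => -[].
Qed.

Lemma d_SAF_ComT (a b : seq nat) : is_composition a -> d_SAF a b = d_ComT a b.
Proof.
move=> ca; apply: (@card_set_bij _ _ _ _ drop_empty).
- exact: finite_d_SAF_set.
- exact: finite_d_ComT_set.
have -> : d_SAF_set a b = SSAFs a `&`
    [set T | perm_eq (flatten T) (iota 1 (sumn a)) /\ descent_composition T = b].
  apply/seteqP; split=> T.
    move=> [[g [lg ga] [gT cT]] Tb]; split; first by exists g.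
    by split=> //; rewrite -ga sumn_compress; apply/eq_seq_msetP.
  move=> [[g ag gT] [Ta Tb]]; split=> //; exists g => //; split=> //.
  by case: ag => _ ga; apply/eq_seq_msetP; rewrite -sumn_compress ga.
have -> : d_ComT_set a b = ComT a `&`
    [set T | perm_eq (flatten T) (iota 1 (sumn a)) /\ descent_composition T = b].
  by apply/seteqP; split=> T /=; [move=> [[]]|move=> [? []]].
apply: set_bij_setI; first exact: drop_empty_bij.
by move=> T _ /=; rewrite flatten_drop_empty descent_composition_drop_empty.
Qed.

Lemma ComT_content_std (a : seq nat) (m : monomial) :
  (\sum_(T \in ComT a `&` [set T | m = content T]) (1 : int) =
   \sum_(S \in standard_ComT a) qsym_F (descent_composition S) m)%R.
Proof.
have cE T : m = content T <-> perm_eq (flatten T) (sort leq m).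
  rewrite perm_sym perm_sort perm_sym; split; first exact: content_perm.
  by move=> Tm; rewrite -[m]seq_mset_id; apply/esym/eq_seq_msetP.
(* If [x_0] divides [m], both sides vanish: entries are positive and no fundamental function
   involves [x_0]. *)
have [m0|m0] := boolP (0 \in m).
  rewrite !fsbig1 // => [S _|T [aT /= mT]]; first by rewrite qsym_F_coef m0.
  have [_ posT _ _ _] := aT; rewrite positive_entriesE in posT.
  by move: m0; rewrite -(perm_mem (content_perm mT)) => /(allP posT).
rewrite (_ : _ `&` _ = [set T | ComT a T /\ perm_eq (flatten T) (sort leq m)]); last first.
  by apply/seteqP; split=> T [aT /cE mT].
rewrite (reindex_fsbig _ _ _ (fun=> 1%R) (destandardize_bij a _ _)).
- transitivity (\sum_(S \in standard_ComT a `&` [set S | sumn a = size (sort leq m) /\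
      increases_at (sort leq m) (descents S)]) (1 : int))%R.
    by apply: eq_fsbigl; apply/seteqP; split=> S /=; [case|case=> ? []].
  rewrite fsbig_mkcondr; apply: eq_fsbigr => S; rewrite inE => -[[Sa _ _ _ _] _].
  rewrite qsym_F_coef m0 /=; have := coarsening_descents S m.
  rewrite size_flatten Sa size_sort => cd.
  case: asboolP => [/cd H|H]; first by rewrite ifT // inE.
  by rewrite ifF //; apply/negbTE/negP; rewrite inE => /cd.
- exact/sort_sorted/leq_total.
- apply/allP => x; rewrite mem_sort lt0n => xm.
  by apply: contraNneq m0 => <-.
Qed.

Local Open Scope ring_scope.

Theorem theorem6p2 (a : seq nat) (ha : is_composition a) :
  quasi_schur a = psum composition_set (fun b => qsym_F b *+ d_SAF a b) /\
  (forall b : seq nat, is_composition b -> d_SAF a b = d_ComT a b).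
Proof.
split=> [|b _]; last exact: d_SAF_ComT.
apply/funext => m; rewrite quasi_schur_coef /psum.
transitivity (\sum_(T \in ComT a `&` [set T | m = content T]) (1 : int)).
  apply/esym/(reindex_fsbig drop_empty _ _ (fun=> 1%R)).
  apply: set_bij_setI; first exact: drop_empty_bij.
  by move=> T _ /=; rewrite /content flatten_drop_empty.
have fstd : finite_set (standard_ComT a).
  apply: (sub_finite_set _ (finite_fillings (iota 1 (sumn a)) (finite_set1 a))).
  by move=> T [[Ta _ _ _ _] ?].
rewrite ComT_content_std.
(* Grouping the standard tableaux by descent composition makes the multiplicities [d_ComT a b]
   appear. *)
rewrite -(@fsum_fiber _ _ composition_set _ descent_composition
                      (fun b => qsym_F b m)) //; last first.
  by move=> S _; apply: descent_composition_composition.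
by apply: eq_fsbigr => b _; rewrite natmulfctE d_SAF_ComT.
Qed.
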